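(* Let $W$ be a $p\times p$ weight matrix function on $[a,b]$ and let $n\ge1$. Let $x_1,\dots,x_k\in\mathbb{R}$ be distinct points, let $m_1,\dots,m_k\ge1$ be integers with $\sum_{i=1}^km_i=np$, and for each $i$ let $v_{i,1},\dots,v_{i,m_i}\in\mathbb{R}^p$ be linearly independent non-zero vectors, let $A_i\in\mathbb{R}^{m_i\times m_i}$, and put $$\Lambda_i=(v_{i,1}\ \cdots\ v_{i,m_i})\,A_i\begin{pmatrix} v_{i,1}^T\\ \vdots\\ v_{i,m_i}^T\end{pmatrix}\in\mathbb{R}^{p\times p}.$$ Then the quadrature formula $$\int_a^bF(x)\,W(x)\,G(x)^T\,dx\simeq\sum_{i=1}^kF(x_i)\,\Lambda_i\,G(x_i)^T$$ cannot be exact (i.e. hold with equality) for all $p\times p$ matrix polynomials $F(x)$ and $G(x)$ satisfying $\deg F(x)+\deg G(x)\le 2n$.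
   Context: A weight matrix function on $[a,b]$ is a symmetric $p\times p$ real matrix-valued function $W(x)$, integrable over $[a,b]$ (with finite moments), such that $W(x)\ge 0$ (positive semidefinite) and $\det W(x)\neq 0$ almost everywhere on $[a,b]$. A matrix polynomial is a polynomial in the real variable $x$ with coefficients in $\mathbb{R}^{p\times p}$. Integrals of matrix functions are taken entrywise. *)

(* Defs.v *)
From HB Require Import structures.
From mathcomp Require Import all_boot all_order all_algebra.
From mathcomp Require Import all_classical all_reals all_analysis.

Set Implicit Arguments.
Unset Strict Implicit.
Unset Printing Implicit Defensive.

Import Order.TTheory GRing.Theory Num.Theory.
Import numFieldNormedType.Exports.

Local Open Scope classical_set_scope.
Local Open Scope ring_scope.

(* Square matrices have size p.+1: this is the standing convention p >= 1, and
   it makes 'M[R]_p.+1 a nontrivial ring, so that a matrix polynomial is an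
   element of {poly 'M[R]_p.+1}. *)

Definition psdmx (R : realType) (p : nat) (M : 'M[R]_p) : Prop :=
  forall u : 'cV[R]_p, 0 <= (u^T *m M *m u) ord0 ord0.

(* The case k = 0 of [weight_moments] is the integrability of W. *)
Record weight_matrix (R : realType) (p : nat) (a b : R) (W : R -> 'M[R]_p) :
    Prop := WeightMatrix {
  weight_sym : forall x, x \in `[a, b] -> (W x)^T = W x ;
  weight_moments : forall (k : nat) (i j : 'I_p),
    (@lebesgue_measure R).-integrable `[a, b]
      (fun x : R => (x ^+ k * W x i j)%:E) ;
  weight_psd_det : {ae (@lebesgue_measure R), forall x, x \in `[a, b] ->
    psdmx (W x) /\ \det (W x) != 0}
}.

Definition mx_integral (R : realType) (p : nat) (a b : R)
    (H : R -> 'M[R]_p) : 'M[R]_p :=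
  \matrix_(i, j) \int[@lebesgue_measure R]_(x in `[a, b]) (H x i j).

(* x%:M is central, so this is F(x) = \sum_j x ^+ j *: F`_j. *)
Definition mxpoly_eval (R : realType) (p : nat) (F : {poly 'M[R]_p.+1})
    (x : R) : 'M[R]_p.+1 := F.[x%:M].

(* The zero polynomial gets degree 0; the quadrature formula is
   trivially exact as soon as F = 0 or G = 0, so its degree is immaterial. *)
Definition mxpoly_deg (R : realType) (p : nat) (F : {poly 'M[R]_p.+1}) : nat :=
  (size F).-1.

Definition quadrature_coef (R : realType) (p m : nat)
    (v : 'I_m -> 'cV[R]_p) (A : 'M[R]_m) : 'M[R]_p :=
  (\matrix_(r < p, j < m) v j r ord0) *m A *m (\matrix_(j < m) (v j)^T).

Definition quadrature_exact (R : realType) (p : nat) (a b : R)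
    (W : R -> 'M[R]_p.+1) (k : nat) (x : 'I_k -> R)
    (L : 'I_k -> 'M[R]_p.+1) (F G : {poly 'M[R]_p.+1}) : Prop :=
  mx_integral a b (fun t => mxpoly_eval F t *m W t *m (mxpoly_eval G t)^T) =
  \sum_(i < k) mxpoly_eval F (x i) *m L i *m (mxpoly_eval G (x i))^T.

(* Main.v *)
(* Killing the n p vectors v_(i,j) at the nodes imposes n p linear conditions on
   the (n + 1) p coefficients of a row polynomial of degree at most n, so some
   nonzero row q satisfies q(x_i) v_(i,j) = 0 for all i, j. Let every row of F be
   q. Then F(x_i) L_i = 0, so exactness for G = F gives that the integral of
   q W q^T vanishes. As W is positive definite almost everywhere, q vanishes
   almost everywhere on [a, b], which a nonzero polynomial cannot do. *)
Require Import Defs.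
From HB Require Import structures.
From mathcomp Require Import all_boot all_order all_algebra.
From mathcomp Require Import all_classical all_reals all_analysis.
From mathcomp Require Import ring.

Set Implicit Arguments.
Unset Strict Implicit.
Unset Printing Implicit Defensive.

Import Order.TTheory GRing.Theory Num.Theory.
Import numFieldNormedType.Exports.

Local Open Scope ring_scope.

(** The coefficient matrix has more rows than its rank, so its left kernel contains a nonzero row.
    Arbitrary finite index types allow pairs as unknowns and dependent pairs as equations. *)
Lemma homogeneous_system_nontrivial (K : fieldType) (S T : finType)
    (c : S -> T -> K) :
  (#|T| < #|S|)%N ->
  exists2 y : S -> K, exists s, y s != 0 & forall t, \sum_s y s * c s t = 0.
Proof.
move=> ltTS.
pose M : 'M[K]_(#|S|, #|T|) := \matrix_(i, j) c (enum_val i) (enum_val j).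
have : kermx M != 0.
  by rewrite kermx_eq0 -row_leq_rank -ltnNge (leq_ltn_trans (rank_leq_col _)).
rewrite -nz_row_eq0 => /rV0Pn[i0 nz_i0]; set w := nz_row _ in nz_i0.
exists (fun s => w 0 (enum_rank s)); first by exists (enum_val i0); rewrite enum_valK.
move=> t; have /sub_kermxP wM := nz_row_sub (kermx M).
have /rowP/(_ (enum_rank t)) := wM; rewrite [RHS]mxE => wMt.
rewrite -[RHS]wMt mxE (reindex _ (onW_bij _ (enum_val_bij S))) /=.
by apply: eq_bigr => i _; rewrite enum_valK mxE enum_rankK.
Qed.

(** The [n * p] coefficients of the [q r] are the unknowns, and each pair [(i, j)] gives one
    homogeneous linear equation in them. *)
Lemma row_interpolation (K : fieldType) (p n k : nat) (x : 'I_k -> K)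
    (m : 'I_k -> nat) (v : forall i, 'I_(m i) -> 'cV[K]_p) :
  (\sum_(i < k) m i < n * p)%N ->
  exists q : 'I_p -> {poly K},
    [/\ exists r, q r != 0, forall r, (size (q r) <= n)%N &
        forall i j, \sum_r (q r).[x i] * v i j r ord0 = 0].
Proof.
move=> lt_m.
pose T := {i : 'I_k & 'I_(m i)}.
have [|y [[l r] nz_y] y0] := @homogeneous_system_nontrivial K
    ('I_n * 'I_p)%type T (fun s t => x (tag t) ^+ s.1 * v (tag t) (tagged t) s.2 ord0).
  rewrite card_prod !card_ord card_tagged sumnE big_map big_enum /=.
  by under eq_bigr do rewrite card_ord.
(* [insub] turns the exponent into an ordinal; below [n] it succeeds, so the default 0 is never a
   coefficient. *)
pose q r := \poly_(j < n) oapp (fun j => y (j, r)) 0 (insub j).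
have qE r' (j : 'I_n) : (q r')`_j = y (j, r').
  by rewrite coef_poly ltn_ord valK.
exists q; split=> [|r'|i j].
- by exists r; apply: contra nz_y => /eqP q0; rewrite -qE q0 coef0.
- exact: size_poly.
rewrite -[RHS](y0 (Tagged (fun i => 'I_(m i)) j)) /=.
transitivity (\sum_l \sum_r' y (l, r') * (x i ^+ l * v i j r' ord0)); last first.
  by rewrite pair_bigA; apply: eq_bigr => -[].
rewrite exchange_big /=.
apply: eq_bigr => r' _; rewrite (horner_coef_wide _ (size_poly _ _)) mulr_suml.
by apply: eq_bigr => l' _; rewrite qE mulrA.
Qed.

(** A zero [u] of the form is a minimum of it, so the gradient [2 M u] vanishes there, and [M] is
    invertible. *)
Lemma psdmx_posdef (R : realType) (p : nat) (M : 'M[R]_p) (u : 'cV[R]_p) :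
  M^T = M -> psdmx M -> \det M != 0 -> (u^T *m M *m u) ord0 ord0 = 0 -> u = 0.
Proof.
move=> symM psdM detM qu0.
have uM : M \in unitmx by rewrite unitmxE unitfE.
suff Mu0 : M *m u = 0 by rewrite -(mulKmx uM u) Mu0 mulmx0.
pose w := M *m u.
pose s := (w^T *m w) ord0 ord0; pose d := (w^T *m M *m w) ord0 ord0.
have sE : s = \sum_i w i ord0 ^+ 2.
  by rewrite /s mxE; apply: eq_bigr => i _; rewrite mxE expr2.
have s_ge0 : 0 <= s by rewrite sE sumr_ge0 // => i _; rewrite sqr_ge0.
(* At u + t M u the form is 2 t |M u|^2 + O(t^2), so its nonnegativity for small
   negative t forces M u = 0. *)
have quad t : 0 <= t * (s *+ 2) + t ^+ 2 * d.
  have wE : u^T *m M *m w = w^T *m w by rewrite /w trmx_mul symM.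
  have := psdM (u + t *: w).
  rewrite [(u + _)^T]linearD /= [(t *: w)^T]linearZ /= !mulmxDl !mulmxDr.
  rewrite -!scalemxAl -!scalemxAr -(mulmxA w^T M u) -/w wE.
  rewrite /s /d; move: qu0; move: (u^T *m M *m u) (w^T *m w) (w^T *m M *m w).
  move=> X Y Z X0; rewrite !mxE X0.
  by rewrite add0r mulr2n mulrDr expr2 -mulrA addrA.
have d_ge0 : 0 <= d := psdM w.
have s0 : s = 0.
  have e1 : (1 + d)^-1 * (1 + d) = 1 by rewrite mulVf // lt0r_neq0 // ltr_wpDr.
  have e_gt0 : 0 < (1 + d)^-1 by rewrite invr_gt0 ltr_wpDr.
  (* The quadratic in [t] is least at [- s / d]; [1 + d] replaces [d], which may be 0, and the value
     is still negative unless [s = 0]. *)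
  have := quad (- s * (1 + d)^-1); move: ((1 + d)^-1) e1 e_gt0 => e e1 e_gt0.
  have -> : - s * e * (s *+ 2) + (- s * e) ^+ 2 * d = - (s ^+ 2 * (e * (1 + e))).
    have ed : e * d = 1 - e by rewrite -e1; ring.
    transitivity (- (s ^+ 2 * e * 2) + s ^+ 2 * e * (e * d)); first by ring.
    by rewrite ed; ring.
  rewrite oppr_ge0 pmulr_lle0 ?mulr_gt0 ?addr_gt0 // => s2_le0.
  by apply/eqP; rewrite -sqrf_eq0 eq_le s2_le0 sqr_ge0.
apply/colP => i; rewrite [RHS]mxE; apply/eqP; rewrite -sqrf_eq0.
move: s0; rewrite sE => /eqP; rewrite psumr_eq0 => [|l _]; last exact: sqr_ge0.
by move=> /allP/(_ i (mem_index_enum _)).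
Qed.

Lemma weight_poly_integrable (R : realType) (p : nat) (a b : R)
    (W : R -> 'M[R]_p) (P : {poly R}) (i j : 'I_p) :
  weight_matrix a b W ->
  (@lebesgue_measure R).-integrable `[a, b]%classic
    (fun t : R => (P.[t] * W t i j)%:E).
Proof.
move=> [_ moments _].
have mD : measurable (`[a, b]%classic : set R) by [].
have -> : (fun t : R => (P.[t] * W t i j)%:E) =
    (fun t => \sum_(l < size P) (P`_l)%:E * (t ^+ l * W t i j)%:E)%E.
  apply/funext => t; rewrite horner_coef mulr_suml -sumEFin.
  by apply: eq_bigr => l _; rewrite -mulrA EFinM.
by apply: integrable_sum => // l _; apply: integrableZl.
Qed.

Lemma ae_eq0_of_Rintegral0 d (T : measurableType d) (R : realType)
    (mu : {measure set T -> \bar R}) (D : set T) (f : T -> R) :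
  measurable D -> mu.-integrable D (EFin \o f) ->
  {ae mu, forall x, D x -> 0 <= f x} ->
  \int[mu]_(x in D) f x = 0 -> {ae mu, forall x, D x -> f x = 0}.
Proof.
move=> mD intf f_ge0 if0.
have /integrableP[mf _] := intf.
have abs0 : (\int[mu]_(x in D) `|(EFin \o f) x| = 0)%E.
  rewrite (@ae_eq_integral _ _ _ mu D (EFin \o f)) //.
  (* The real integral is [fine] of the extended one, and [fine] also sends infinities to 0;
     integrability excludes that case. *)
  - by rewrite -[LHS]fineK ?integrable_fin_num //; congr EFin.
  - by case/integrableP: (integrable_abse intf).
  by apply: filterS f_ge0 => x f_ge0 Dx /=; rewrite ger0_norm ?f_ge0.
have /(ae_eq_integral_abs mu mD mf) := abs0.
by apply: filterS => x fx0 /fx0[].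
Qed.

Lemma finite_set_roots (D : idomainType) (P : {poly D}) :
  P != 0 -> finite_set [set x | root P x]%classic.
Proof.
move=> P0; apply: contrapT => /(infinite_set_fset (size P))[B rootB].
rewrite leqNgt max_poly_roots ?finmap.fset_uniq //.
by apply/allP => z /rootB.
Qed.

(** Otherwise the exceptional null set and the finitely many roots of [P] would cover an interval of
    positive length. *)
Lemma ae_root_itv_poly0 (R : realType) (a b : R) (P : {poly R}) :
  a < b ->
  {ae @lebesgue_measure R, forall x, x \in `[a, b] -> root P x} -> P = 0.
Proof.
move=> ab aeP; apply/eqP/negPn/negP => P0.
have finroots := finite_set_roots P0.
have neg1 : (@lebesgue_measure R).-negligible [set x | root P x]%classic.
  exists [set x | root P x]%classic; split => //.
    exact: countable_measurable (finite_set_countable finroots).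
  by apply/countable_lebesgue_measure0/finite_set_countable.
have neg2 : (@lebesgue_measure R).-negligible `[a, b]%classic.
  apply: negligibleS (negligibleU aeP neg1) => t abt /=.
  have [rt|nrt] := boolP (root P t); first by right.
  by left=> /(_ abt); apply/negP.
have : (@lebesgue_measure R) `[a, b]%classic = 0%E.
  by apply: measure_negligible neg2; exact: measurable_itv.
rewrite lebesgue_measure_itv /= lte_fin ab -EFinD => -[] /eqP.
by rewrite subr_eq0 gt_eqF.
Qed.

Theorem theorem5p1 (R : realType) (p : nat) (a b : R) (W : R -> 'M[R]_p.+1)
    (n k : nat) (x : 'I_k -> R) (m : 'I_k -> nat)
    (v : forall i : 'I_k, 'I_(m i) -> 'cV[R]_p.+1)
    (A : forall i : 'I_k, 'M[R]_(m i)) :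
  a < b ->
  weight_matrix a b W ->
  (1 <= n)%N ->
  injective x ->
  (forall i, (1 <= m i)%N) ->
  (\sum_(i < k) m i = n * p.+1)%N ->
  (forall i j, v i j != 0) ->
  (forall i, free [seq v i j | j : 'I_(m i)]) ->
  ~ (forall F G : {poly 'M[R]_p.+1},
       (mxpoly_deg F + mxpoly_deg G <= 2 * n)%N ->
       quadrature_exact a b W x (fun i => quadrature_coef (v i) (A i)) F G).
Proof.
move=> ab wW _ _ _ sum_m _ _ exact_all.
(* Size at most [n.+1] means degree at most [n]: there are [n.+1 * p.+1] coefficients against
   [n * p.+1] conditions. *)
have [|q [[r0 nz_q] size_q qv0]] := @row_interpolation R p.+1 n.+1 k x m v.
  by rewrite sum_m ltn_pmul2r.
pose F : {poly 'M[R]_p.+1} := \poly_(j < n.+1) \matrix_(_, r) (q r)`_j.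
have FE t i r : mxpoly_eval F t i r = (q r).[t].
  rewrite /mxpoly_eval horner_poly summxE (horner_coef_wide _ (size_q r)).
  apply: eq_bigr => j _; rewrite -rmorphXn /= -mulmxE mul_mx_scalar.
  by rewrite !mxE mulrC.
have degF : (mxpoly_deg F <= n)%N by rewrite /mxpoly_deg -subn1 leq_subLR size_poly.
have : quadrature_exact a b W x (fun i => quadrature_coef (v i) (A i)) F F.
  by apply: exact_all; rewrite mul2n -addnn leq_add.
have Fv0 i : mxpoly_eval F (x i) *m quadrature_coef (v i) (A i) = 0.
  rewrite /quadrature_coef !mulmxA [X in X *m _ *m _](_ : _ = 0) ?mul0mx //.
  apply/matrixP => l j; rewrite !mxE -[RHS](qv0 i j).
  by apply: eq_bigr => r _; rewrite FE mxE.
rewrite /quadrature_exact big1 => [|i _]; last by rewrite Fv0 mul0mx.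
(* The rows of [F] coincide, so all entries of this identity agree and one suffices. *)
move=> /matrixP/(_ ord0 ord0); rewrite !mxE.
pose u t : 'cV[R]_p.+1 := \col_r (q r).[t].
have formE t : (mxpoly_eval F t *m W t *m (mxpoly_eval F t)^T) ord0 ord0 =
               ((u t)^T *m W t *m u t) ord0 ord0.
  rewrite mxE [RHS]mxE; apply: eq_bigr => s _; rewrite [_^T s _]mxE FE [u t _ _]mxE.
  by congr (_ * _); rewrite !mxE; apply: eq_bigr => r _; rewrite FE !mxE.
(* This expansion reduces integrability of the form to that of polynomial multiples of the entries
   of [W], hence to the moments. *)
have formsum t : ((u t)^T *m W t *m u t) ord0 ord0 =
    \sum_s \sum_r (q r * q s).[t] * W t r s.
  rewrite mxE; apply: eq_bigr => s _; rewrite mxE mulr_suml.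
  by apply: eq_bigr => r _; rewrite !mxE hornerM mulrAC.
move=> int0.
have form_ge0 : {ae @lebesgue_measure R, forall t, t \in `[a, b] ->
    0 <= ((u t)^T *m W t *m u t) ord0 ord0}.
  move: (weight_psd_det wW); apply: (@filterS _ (almost_everywhere (@lebesgue_measure R))) => t psd_det /psd_det[psdW _].
  exact: psdW.
have form0 : {ae @lebesgue_measure R, forall t, t \in `[a, b] ->
    ((u t)^T *m W t *m u t) ord0 ord0 = 0}.
  apply: (@ae_eq0_of_Rintegral0 _ _ R lebesgue_measure `[a, b]%classic) => //.
  - have -> : EFin \o (fun t => ((u t)^T *m W t *m u t) ord0 ord0) =
        (fun t => \sum_s \sum_r ((q r * q s).[t] * W t r s)%:E)%E.
      apply/funext => t /=; rewrite formsum -sumEFin.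
      by apply: eq_bigr => s _; rewrite -sumEFin.
    by do 2!(apply: integrable_sum => // ? _); apply: weight_poly_integrable.
  - by rewrite -[RHS]int0; apply: eq_Rintegral => t _; rewrite formE.
(* At almost every [t] definiteness gives [u t = 0], so the nonzero component [q r0] would have
   almost every point of the interval as a root. *)
suff : q r0 = 0 by apply/eqP.
apply: (ae_root_itv_poly0 ab).
move: form0 (weight_psd_det wW); apply: (@filterS2 _ (almost_everywhere (@lebesgue_measure R))) => t form0 psd_det abt.
have [psdW detW] := psd_det abt.
have /colP/(_ r0) := psdmx_posdef (weight_sym wW abt) psdW detW (form0 abt).
by rewrite !mxE rootE => ->.
Qed.
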